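(* Let $p$ be a prime, $\mathbf{F}$ a field of characteristic $p$ and $m\ge 1$. Choose a basis $\{X_i,Y_i\mid i=1,\ldots,m\}$ of $(mV_2)^*$ with $\Delta(Y_i)=X_i$ and $\Delta(X_i)=0$, and use the graded reverse lexicographic order with $X_i<Y_i<X_{i+1}$. Then a reduced Gröbner basis for the Hilbert ideal of $mV_2$ is given by $\{X_i,Y_i^p\mid i=1,\ldots,m\}$; the corresponding monomial basis for $\mathbf{F}[mV_2]_{\mathbf{Z}/p}$ is given by the monomial factors (divisors) of $(y_1\cdots y_m)^{p-1}$; and $\mathbf{F}[mV_2]_{\mathbf{Z}/p}$ is a trivial $\mathbf{F}\mathbf{Z}/p$-module.
   Context: For $n\le p$, $V_n$ is the $n$-dimensional indecomposable representation over $\mathbf{F}$ of the cyclic group $\mathbf{Z}/p=\langle\sigma\rangle$ on which $\sigma$ acts by a single Jordan block with eigenvalue $1$; $mV_n$ is the direct sum of $m$ copies. For a representation $V$, the action on $V^*$ extends to algebra automorphisms of $\mathbf{F}[V]=S(V^* )$; $\Delta:=\sigma-1$. The Hilbert ideal is the ideal of $\mathbf{F}[V]$ generated by all homogeneous invariants of positive degree, and the ring of coinvariants $\mathbf{F}[V]_{\mathbf{Z}/p}$ is the quotient of $\mathbf{F}[V]$ by the Hilbert ideal, with its induced $\mathbf{Z}/p$-action. Lower case letters denote images in the coinvariants of the variables written in upper case. The monomial basis corresponding to a Gröbner basis consists of the images of the monomials not divisible by any leading monomial of the Gröbner basis. *)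

(* Defs.v *)
From HB Require Import structures.
From mathcomp Require Import all_boot all_order all_algebra.
From mathcomp Require Import boolp.
From mathcomp.multinomials Require Import mpoly.

Set Implicit Arguments.
Unset Strict Implicit.
Unset Printing Implicit Defensive.

Import GRing.Theory.
Local Open Scope ring_scope.
Local Open Scope quotient_scope.

Section Algebra.

Definition ideal_gen (R : comNzRingType) (S : R -> Prop) (f : R) : Prop :=
  exists (k : nat) (a g : 'I_k -> R),
    (forall i, S (g i)) /\ f = \sum_(i < k) a i * g i.

(* The family [e], restricted to the indices satisfying [P], is a basis of [U]
   (which need not be known to be finite-dimensional). *)
Definition basis_family (F : fieldType) (U : lmodType F) (I : eqType)
    (P : I -> Prop) (e : I -> U) : Prop :=
  (forall u : U, exists (r : seq I) (c : I -> F),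
     (forall i, i \in r -> P i) /\ u = \sum_(i <- r) c i *: e i)
  /\ (forall (r : seq I) (c : I -> F), uniq r -> (forall i, i \in r -> P i) ->
     \sum_(i <- r) c i *: e i = 0 -> forall i, i \in r -> c i = 0).

End Algebra.

Section Groebner.

Variable n : nat.

(* Graded reverse lexicographic order for which the variables increase with
   their index: 'X_0 < 'X_1 < ...  For monomials of equal degree, the one with
   the larger exponent at the smallest variable where they differ is smaller.
   The order [<=%O] that mpoly puts on ['X_{1..n}] is degree-lexicographic,
   with the variables decreasing, hence [mlead] cannot be used here. *)
Definition grevlex_lt (a b : 'X_{1..n}) : bool :=
  (mdeg a < mdeg b)%N ||
  (mdeg a == mdeg b) &&
    [exists k : 'I_n, (b k < a k)%N &&
       [forall l : 'I_n, (l < k)%N ==> (a l == b l)]].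

Definition grevlex_le (a b : 'X_{1..n}) : bool := (a == b) || grevlex_lt a b.

Variable F : fieldType.
Implicit Types (f g : {mpoly F[n]}) (G : seq {mpoly F[n]}).

Definition is_lm f (t : 'X_{1..n}) : Prop :=
  t \in msupp f /\ forall u, u \in msupp f -> grevlex_le u t.

Definition lm_ideal (S : {mpoly F[n]} -> Prop) : {mpoly F[n]} -> Prop :=
  ideal_gen (fun h => exists f t, [/\ S f, is_lm f t & h = 'X_[t]]).

Definition is_groebner (I : {mpoly F[n]} -> Prop) G : Prop :=
  (forall g, g \in G -> I g) /\
  (forall h, lm_ideal (fun g => g \in G) h <-> lm_ideal I h).

Definition is_reduced_groebner (I : {mpoly F[n]} -> Prop) G : Prop :=
  [/\ is_groebner I G,
      forall g, g \in G -> exists2 t, is_lm g t & g@_t = 1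
    & forall g h t u, g \in G -> h \in G -> g != h -> is_lm h t ->
        u \in msupp g -> ~~ (t <= u)%MM].

Definition standard_monomial G (u : 'X_{1..n}) : Prop :=
  forall g t, g \in G -> is_lm g t -> ~~ (t <= u)%MM.

End Groebner.

Section Representation.

Variables (p : nat) (F : fieldType) (V : vectType F).

(* A representation of Z/p = <sigma> is given by the endomorphism [s] of [V]
   by which sigma acts.  It is isomorphic to m V_n when V has a basis made of
   m Jordan chains of length n for the eigenvalue 1. *)
Definition is_mV (m n : nat) (s : 'End(V)) : Prop :=
  exists2 e : 'I_m -> 'I_n -> V,
    basis_of fullv (codom (fun ij : 'I_m * 'I_n => e ij.1 ij.2)) &
    forall i j, s (e i j) = e i j + \sum_(k < n | k.+1 == j :> nat) e i k.

Definition dual := 'Hom(V, F^o).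

(* (sigma phi)(v) = phi (sigma^-1 v) *)
Definition dual_act (s : 'End(V)) (phi : dual) : dual := (phi \o s^-1)%VF.

Definition dual_Delta (s : 'End(V)) (phi : dual) : dual := dual_act s phi - phi.

Variables (n : nat) (s : 'End(V)) (b : n.-tuple dual).

(* A basis [b] of V^* identifies F[V] = S(V^* ) with {mpoly F[n]}, the variable
   'X_k standing for the k-th element of [b]; sigma acts by the algebra
   morphism extending its action on V^*. *)
Definition sigma_act (f : {mpoly F[n]}) : {mpoly F[n]} :=
  f \mPo [tuple \sum_(l < n) coord b l (dual_act s (tnth b k)) *: 'X_l | k < n].

Definition zp_act (k : 'Z_p) (f : {mpoly F[n]}) : {mpoly F[n]} :=
  iter k sigma_act f.

Definition zp_invariant (f : {mpoly F[n]}) : Prop := forall k, zp_act k f = f.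

Definition hilbert_ideal : {mpoly F[n]} -> Prop :=
  ideal_gen (fun f =>
    (exists2 d, (0 < d)%N & f \is d.-homog) /\ zp_invariant f).

Definition hilbert_pred : {pred {mpoly F[n]}} := fun f => `[< hilbert_ideal f >].

Lemma hilbertP f : reflect (hilbert_ideal f) (f \in hilbert_pred).
Proof. exact: asboolP. Qed.

Lemma hilbert_mull a f : hilbert_ideal f -> hilbert_ideal (a * f).
Proof.
move=> [k [c [g [Sg ->]]]]; exists k, (fun i => a * c i), g; split=> //.
by rewrite mulr_sumr; apply: eq_bigr => i _; rewrite mulrA.
Qed.

Lemma hilbert_add f g :
  hilbert_ideal f -> hilbert_ideal g -> hilbert_ideal (f + g).
Proof.
move=> [k [c [h [Sh ->]]]] [k' [c' [h' [Sh' ->]]]].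
exists (k + k')%N,
  (fun i => match split i with inl j => c j | inr j => c' j end),
  (fun i => match split i with inl j => h j | inr j => h' j end).
split=> [i|]; first by case: (split i).
rewrite big_split_ord /=; congr (_ + _); apply: eq_bigr => i _.
  by rewrite (unsplitK (inl i)).
by rewrite (unsplitK (inr i)).
Qed.

Lemma hilbert_idealr_closed : idealr_closed hilbert_pred.
Proof.
split=> [||a f g /hilbertP If /hilbertP Ig]; last first.
- by apply/hilbertP/hilbert_add => //; apply: hilbert_mull.
- apply/hilbertP => -[k [c [g [Sg /(congr1 (mcoeff 0%MM))]]]].
  rewrite mcoeff1 eqxx raddf_sum big1 => [/eqP|i _]; first by rewrite oner_eq0.
  have [[d d_gt0 Hg] _] := Sg i.
  have mcoeff0M : {morph mcoeff 0%MM : u v / u * v} := rmorphM _.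
  rewrite /= mcoeff0M (dhomog_nemf_coeff Hg) ?mulr0 //.
  by rewrite /= mdeg0 eq_sym -lt0n.
- apply/hilbertP; exists 0%N, (fun=> 0), (fun=> 0).
  by split=> [[]|] //; rewrite big_ord0.
Qed.

HB.instance Definition _ := isIdealr.Build _ hilbert_pred hilbert_idealr_closed.

Definition coinvariants : Type := {ideal_quot hilbert_pred}.

HB.instance Definition _ := GRing.ComNzRing.on coinvariants.
HB.instance Definition _ := EqQuotient.on coinvariants.

Definition coinv_class (f : {mpoly F[n]}) : coinvariants :=
  \pi_coinvariants f.

Lemma coinv_classP f g :
  coinv_class f = coinv_class g <-> hilbert_ideal (f - g).
Proof.
split=> [/eqP|/hilbertP].
  by rewrite -Quotient.idealrBE => /hilbertP.
by rewrite Quotient.idealrBE => /eqP.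
Qed.

Definition coinv_scale (c : F) (x : coinvariants) : coinvariants :=
  coinv_class c%:MP * x.

Lemma coinv_scaleA c d x :
  coinv_scale c (coinv_scale d x) = coinv_scale (c * d) x.
Proof. by rewrite /coinv_scale mulrA /coinv_class -rmorphM /= mpolyCM. Qed.

Lemma coinv_scale1 : left_id 1 coinv_scale.
Proof. by move=> x; rewrite /coinv_scale /coinv_class mpolyC1 rmorph1 mul1r. Qed.

Lemma coinv_scaleDr : right_distributive coinv_scale +%R.
Proof. by move=> c x y; rewrite /coinv_scale mulrDr. Qed.

Lemma coinv_scaleDl x : {morph coinv_scale^~ x : c d / c + d}.
Proof.
by move=> c d; rewrite /coinv_scale /coinv_class mpolyCD rmorphD mulrDl.
Qed.

HB.instance Definition _ := GRing.Zmodule_isLmodule.Build F coinvariants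
  coinv_scaleA coinv_scale1 coinv_scaleDr coinv_scaleDl.

Definition coinv_act (k : 'Z_p) (x : coinvariants) : coinvariants :=
  coinv_class (zp_act k (repr x)).

Lemma coinv_actE k f : coinv_act k (coinv_class f) = coinv_class (zp_act k f).
Proof.
have actB u v : zp_act k (u - v) = zp_act k u - zp_act k v.
  rewrite /zp_act; elim: (k : nat) => //= j ->.
  by rewrite /sigma_act comp_mpolyB.
have actM u v : zp_act k (u * v) = zp_act k u * zp_act k v.
  rewrite /zp_act; elim: (k : nat) => //= j ->.
  by rewrite /sigma_act rmorphM.
have actD u v : zp_act k (u + v) = zp_act k u + zp_act k v.
  rewrite /zp_act; elim: (k : nat) => //= j ->.
  by rewrite /sigma_act comp_mpolyD.
apply/coinv_classP; rewrite -actB.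
have /coinv_classP[l [c [g [Sg ->]]]] :
    coinv_class (repr (coinv_class f)) = coinv_class f by exact: reprK.
exists l, (fun i => zp_act k (c i)), g; split=> //.
have act0 : zp_act k 0 = 0 by have := actB 0 0; rewrite !subrr.
rewrite (big_morph _ actD act0).
by apply: eq_bigr => i _; rewrite actM; have [_ ->] := Sg i.
Qed.

End Representation.

Section Variables.

(* The variables of F[mV_2] are indexed in increasing order
   X_1 < Y_1 < X_2 < Y_2 < ..., so that X_i and Y_i, for i : 'I_m, have the
   indices 2i and 2i + 1. *)
Variable m : nat.

Fact x_idx_subproof (i : 'I_m) : (i.*2 < m.*2)%N.
Proof. by rewrite ltn_double. Qed.
Definition x_idx (i : 'I_m) : 'I_m.*2 := Ordinal (x_idx_subproof i).

Fact y_idx_subproof (i : 'I_m) : (i.*2.+1 < m.*2)%N.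
Proof. by rewrite ltn_Sdouble. Qed.
Definition y_idx (i : 'I_m) : 'I_m.*2 := Ordinal (y_idx_subproof i).

Fact half_idx_subproof (k : 'I_m.*2) : (k./2 < m)%N.
Proof. by rewrite -ltn_double (leq_ltn_trans _ (ltn_ord k)) ?halfK ?leq_subr. Qed.
Definition half_idx (k : 'I_m.*2) : 'I_m := Ordinal (half_idx_subproof k).

Definition xy_tuple (T : Type) (X Y : 'I_m -> T) : m.*2.-tuple T :=
  [tuple if odd k then Y (half_idx k) else X (half_idx k) | k < m.*2].

Definition xy_groebner (p : nat) (F : fieldType) : seq {mpoly F[m.*2]} :=
  [seq 'X_(x_idx i) | i <- enum 'I_m] ++
  [seq 'X_(y_idx i) ^+ p | i <- enum 'I_m].

End Variables.

(* Main.v *)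
(* sigma acts on F[X, Y] by the shear X_i -> X_i, Y_i -> Y_i + X_i.  Modulo the
   square of the ideal (X_1, ..., X_m), the shear minus the identity is the
   derivation sum_i X_i d/dY_i, so the coefficient of X_i Y^(a - e_i) in
   sigma f - f is a_i times that of Y^a in f.  Hence no monomial Y^a with a <> 0
   and all a_i < p occurs in an invariant f.  As X_i and Y_i^p - X_i^(p-1) Y_i
   are invariant, the Hilbert ideal is the monomial ideal (X_i, Y_i^p). *)
Require Import Defs.
From mathcomp Require Import all_boot all_order all_algebra.
From mathcomp.multinomials Require Import mpoly.
From mathcomp Require Import ring.

Set Implicit Arguments.
Unset Strict Implicit.
Unset Printing Implicit Defensive.

Import GRing.Theory.
Local Open Scope ring_scope.

(** * Generated ideals and Gröbner bases consisting of monomials *)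

Section MonomialIdeals.

Variables (n : nat) (F : fieldType).
Implicit Types (f g : {mpoly F[n]}) (S I : {mpoly F[n]} -> Prop).
Implicit Types (T : seq 'X_{1..n}) (t u : 'X_{1..n}).

(** Constants and variables generate the polynomial ring as a ring, so properties compatible with
    sums and products, such as Taylor estimates or equality of two morphisms, need checking only
    there. *)
Lemma mpoly_alg_ind (P : {mpoly F[n]} -> Prop) :
  (forall c, P c%:MP) -> (forall i, P 'X_i) ->
  (forall f g, P f -> P g -> P (f + g)) ->
  (forall f g, P f -> P g -> P (f * g)) -> forall f, P f.
Proof.
move=> PC PX PD PM; elim/mpolyind=> [|c u f _ _ Pf].
  by rewrite -mpolyC0; apply: PC.
apply: PD => //; rewrite -mul_mpolyC; apply: (PM); first exact: PC.
have P1 : P 1 by rewrite -mpolyC1; apply: (PC).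
rewrite mpolyXE_id; apply: (big_ind P P1 PM) => i _.
by elim: (u i) => [|k IHk]; rewrite ?expr0 // exprS; apply: (PM).
Qed.

Lemma ideal_gen_mem S f : S f -> ideal_gen S f.
Proof.
move=> Sf; exists 1%N, (fun=> 1), (fun=> f); split=> //.
by rewrite big_ord1 mul1r.
Qed.

Lemma ideal_gen_mull S f g : ideal_gen S g -> ideal_gen S (f * g).
Proof.
move=> [k [a [h [Sh ->]]]]; exists k, (fun i => f * a i), h; split=> //.
by rewrite mulr_sumr; apply: eq_bigr => i _; rewrite mulrA.
Qed.

Lemma ideal_gen0 S : ideal_gen S 0.
Proof. by exists 0%N, (fun=> 0), (fun=> 0); split=> [[]|] //; rewrite big_ord0. Qed.

Lemma ideal_genD S f g : ideal_gen S f -> ideal_gen S g -> ideal_gen S (f + g).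
Proof.
move=> [k [a [h [Sh ->]]]] [k' [a' [h' [Sh' ->]]]].
exists (k + k')%N,
  (fun i => match split i with inl j => a j | inr j => a' j end),
  (fun i => match split i with inl j => h j | inr j => h' j end).
split=> [i|]; first by case: (split i).
rewrite big_split_ord /=; congr (_ + _); apply: eq_bigr => i _.
  by rewrite (unsplitK (inl i)).
by rewrite (unsplitK (inr i)).
Qed.

Lemma ideal_gen_sub S S' f :
  (forall g, S g -> ideal_gen S' g) -> ideal_gen S f -> ideal_gen S' f.
Proof.
move=> sSS' [k [a [h [Sh ->]]]]; apply: (big_ind (ideal_gen S')) => [||i _].
- exact: ideal_gen0.
- exact: ideal_genD.
by apply/ideal_gen_mull/sSS'.
Qed.

Lemma is_lmX t u : is_lm ('X_[t] : {mpoly F[n]}) u <-> u = t.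
Proof.
rewrite /is_lm msuppX; split=> [[]|->]; first by rewrite inE => /eqP.
by split=> [|v]; rewrite !inE // => /eqP ->; rewrite /grevlex_le eqxx.
Qed.

Lemma mcoeff_sumX T (c : 'X_{1..n} -> F) u : uniq T ->
  (\sum_(t <- T) c t *: 'X_[t])@_u = if u \in T then c u else 0.
Proof.
move=> uniq_T; rewrite raddf_sum /=; case: ifPn => uT.
  rewrite (bigD1_seq u) //= big1 => [|t /negPf tu].
    by rewrite mcoeffZ mcoeffX eqxx mulr1 addr0.
  by rewrite mcoeffZ mcoeffX tu mulr0.
rewrite big_seq big1 // => t tT; rewrite mcoeffZ mcoeffX.
by case: eqP tT uT => [-> ->|_]; rewrite ?mulr0.
Qed.

Lemma mpolyX_dvd t u : (t <= u)%MM ->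
  'X_[u] = 'X_[u - t] * 'X_[t] :> {mpoly F[n]}.
Proof. by move=> le_tu; rewrite -mpolyXD submK. Qed.

(** The support condition applies in particular to the leading monomial of each element of [I], so
    [T] generates the leading monomial ideal. Each element of the basis is its own only monomial, so
    reducedness is exactly the antichain condition on [T]. *)
Lemma monomial_reduced_groebner I T :
    (forall t, t \in T -> I 'X_[t]) ->
    (forall f u, I f -> u \in msupp f -> has (fun t => (t <= u)%MM) T) ->
    {in T &, forall t u, (t <= u)%MM -> t = u} ->
  is_reduced_groebner I [seq 'X_[t] | t <- T].
Proof.
move=> IT suppI antiT; split.
- split=> [_ /mapP[t Tt ->]|h]; first exact: IT.
  split; apply: ideal_gen_sub => _ [f [t [Sf lm_f ->]]].
    apply: ideal_gen_mem; exists f, t; split=> //.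
    by case/mapP: Sf => u Tu ->; apply: IT.
  have /hasP[u Tu /mpolyX_dvd->] := suppI _ _ Sf lm_f.1.
  apply/ideal_gen_mull/ideal_gen_mem; exists 'X_[u], u; split=> //.
    by rewrite map_f.
  exact/is_lmX.
- by move=> _ /mapP[t _ ->]; exists t; [apply/is_lmX | rewrite mcoeffX eqxx].
- move=> _ _ t u /mapP[a Ta ->] /mapP[b Tb ->] neq_ab /is_lmX->.
  rewrite msuppX inE => /eqP->; apply: contra neq_ab => le_ba.
  by rewrite (antiT b a).
Qed.

Lemma standard_monomialX T u :
  standard_monomial [seq 'X_[F, t] | t <- T] u <->
  ~~ has (fun t => (t <= u)%MM) T.
Proof.
rewrite -all_predC; split=> [std_u | /allP std_u _ t /mapP[v Tv ->] /is_lmX->].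
  by apply/allP => t Tt; apply: (std_u 'X_[t]); rewrite ?map_f //; apply/is_lmX.
exact: std_u.
Qed.


End MonomialIdeals.

(** * The shear, its first-order expansion in the X_i, and coefficients of its fixed points *)

Section Shear.

Variables (m : nat) (F : fieldType).
Implicit Types (f g : {mpoly F[m.*2]}) (u v t : 'X_{1..m.*2}) (i : 'I_m).

Lemma x_idxK : cancel (@x_idx m) (@half_idx m).
Proof. by move=> i; apply/val_inj; rewrite /= doubleK. Qed.

Lemma y_idxK : cancel (@y_idx m) (@half_idx m).
Proof. by move=> i; apply/val_inj; rewrite /= uphalf_double. Qed.

Lemma odd_x_idx i : odd (x_idx i) = false.
Proof. by rewrite /= odd_double. Qed.

Lemma odd_y_idx i : odd (y_idx i).
Proof. by rewrite /= odd_double. Qed.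

(** Rewriting with this splits a claim about all variables into the X case and the Y case. *)
Lemma xy_idxP (k : 'I_m.*2) :
  k = if odd k then y_idx (half_idx k) else x_idx (half_idx k).
Proof.
by apply/val_inj; rewrite -[LHS]odd_double_half; case: (odd k).
Qed.

Lemma x_idx_eq i j : (x_idx i == x_idx j) = (i == j).
Proof. exact: (can_eq x_idxK). Qed.

Lemma y_idx_eq i j : (y_idx i == y_idx j) = (i == j).
Proof. exact: (can_eq y_idxK). Qed.

Lemma x_neq_y i j : (x_idx i == y_idx j) = false.
Proof.
apply/negP => /eqP/(congr1 (fun k : 'I__ => odd k)).
by rewrite odd_x_idx odd_y_idx.
Qed.

Lemma y_neq_x i j : (y_idx i == x_idx j) = false.
Proof. by rewrite eq_sym x_neq_y. Qed.

(** The action of sigma in coordinates, free of [V] and its dual; [sigma_act_shear] makes the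
    link. *)
Definition shear f : {mpoly F[m.*2]} :=
  f \mPo [tuple if odd k then 'X_k + 'X_(x_idx (half_idx k)) else 'X_k | k < m.*2].

Lemma shear_x i : shear 'X_(x_idx i) = 'X_(x_idx i).
Proof. by rewrite /shear comp_mpolyXU -tnth_nth tnth_mktuple odd_x_idx. Qed.

Lemma shear_y i : shear 'X_(y_idx i) = 'X_(y_idx i) + 'X_(x_idx i).
Proof. by rewrite /shear comp_mpolyXU -tnth_nth tnth_mktuple odd_y_idx y_idxK. Qed.

Lemma shearD f g : shear (f + g) = shear f + shear g.
Proof. exact: comp_mpolyD. Qed.

Lemma shearB f g : shear (f - g) = shear f - shear g.
Proof. exact: comp_mpolyB. Qed.

Lemma shearM f g : shear (f * g) = shear f * shear g.
Proof. exact: rmorphM. Qed.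

Lemma shearX f k : shear (f ^+ k) = shear f ^+ k.
Proof. exact: rmorphXn. Qed.

Lemma shearC c : shear c%:MP = c%:MP.
Proof. exact: comp_mpolyC. Qed.

Definition xdeg u := (\sum_(i < m) u (x_idx i))%N.

Lemma xdegD u v : xdeg (u + v)%MM = (xdeg u + xdeg v)%N.
Proof. by rewrite /xdeg -big_split; apply: eq_bigr => i _; rewrite mnmDE. Qed.

(* [f] lies in the [d]-th power of the ideal generated by the [X_i]. *)
Definition xorder d f := forall u, (xdeg u < d)%N -> f@_u = 0.

Lemma xorderD d f g : xorder d f -> xorder d g -> xorder d (f + g).
Proof. by move=> ord_f ord_g u ud; rewrite mcoeffD ord_f ?ord_g ?addr0. Qed.

Lemma xorderM d e f g : xorder d f -> xorder e g -> xorder (d + e) (f * g).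
Proof.
move=> ord_f ord_g u ud; rewrite mcoeffM big1 // => k /eqP def_u.
have [/ord_f->|dk] := ltnP (xdeg k.1) d; first by rewrite mul0r.
rewrite ord_g ?mulr0 // -(ltn_add2l (xdeg k.1)) -xdegD -def_u.
by rewrite (leq_trans ud) ?leq_add2r.
Qed.

Lemma xorder0 f : xorder 0 f.
Proof. by []. Qed.

Lemma xorder_x i : xorder 1 'X_(x_idx i).
Proof.
move=> u; rewrite ltnS leqn0 mcoeffX => /eqP u0.
case: eqP => // def_u; move: u0; rewrite -def_u /xdeg (bigD1 i) //=.
by rewrite mnm1E eqxx.
Qed.

(** The linear term in the Taylor expansion of f(X, Y + X) around Y. *)
Definition xdy f : {mpoly F[m.*2]} := \sum_(i < m) 'X_(x_idx i) * f^`M(y_idx i).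

Lemma xdyD f g : xdy (f + g) = xdy f + xdy g.
Proof.
by rewrite -big_split; apply: eq_bigr => i _; rewrite mderivD mulrDr.
Qed.

Lemma xdyM f g : xdy (f * g) = xdy f * g + f * xdy g.
Proof.
rewrite mulr_suml mulr_sumr -big_split; apply: eq_bigr => i _ /=.
by rewrite mderivM; ring.
Qed.

Lemma xorder_xdy f : xorder 1 (xdy f).
Proof.
apply: (big_ind (xorder 1)) => [u _||i _]; first by rewrite mcoeff0.
  exact: xorderD.
by rewrite -[1%N]addn0; apply: xorderM; [apply: xorder_x | apply: xorder0].
Qed.

Lemma mderivXU (i j : 'I_m.*2) :
  ('X_i : {mpoly F[m.*2]})^`M(j) = (i == j)%:R.
Proof.
rewrite mderivX mnm1E; case: eqP => [->|_]; last by rewrite scale0r.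
have -> : (U_(j) - U_(j) = 0 :> 'X_{1..m.*2})%MM.
  by apply/mnmP=> k; rewrite mnmBE subnn mnm0E.
by rewrite mpolyX0 scale1r.
Qed.

(** The remainder vanishes on constants and variables, and the product rule for [xdy] carries the
    estimate over to products. *)
Lemma shear_taylor f : xorder 2 (shear f - f - xdy f).
Proof.
have ord0 : xorder 2 0 by move=> u _; rewrite mcoeff0.
elim/mpoly_alg_ind: f => [c|k|f g ord_f ord_g|f g ord_f ord_g].
- rewrite shearC /xdy big1 => [|i _]; last by rewrite mderivC mulr0.
  by rewrite !subrr.
- rewrite (xy_idxP k); case: (odd k); rewrite /xdy.
    rewrite shear_y (bigD1 (half_idx k)) //= big1 => [|i /negPf neq_i].
      by rewrite mderivXU eqxx mulr1 addr0 -addrA -opprD subrr.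
    by rewrite mderivXU y_idx_eq eq_sym neq_i mulr0.
  rewrite shear_x big1 => [|i _]; first by rewrite !subrr.
  by rewrite mderivXU x_neq_y mulr0.
- rewrite shearD xdyD.
  suff -> : shear f + shear g - (f + g) - (xdy f + xdy g) =
    (shear f - f - xdy f) + (shear g - g - xdy g) by apply: xorderD.
  by ring.
rewrite shearM xdyM.
(* The remainder of a product splits into terms of orders 2 + 0, 0 + 2 and 1 + 1. *)
suff -> : shear f * shear g - f * g - (xdy f * g + f * xdy g) =
  (shear f - f - xdy f) * shear g + (f + xdy f) * (shear g - g - xdy g)
  + xdy f * xdy g.
  apply: xorderD; last exact: (@xorderM 1 1 _ _ (xorder_xdy f) (xorder_xdy g)).
  apply: xorderD; first exact: (@xorderM 2 0 _ _ ord_f (xorder0 _)).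
  exact: (@xorderM 0 2 _ _ (xorder0 _) ord_g).
by ring.
Qed.

(* Compare the coefficients of [X_i Y^(u - e_i)] on both sides of
   [shear f = f]. *)
Lemma shear_inv_coeff f u i : xdeg u = 0%N -> (0 < u (y_idx i))%N ->
  shear f = f -> f@_u *+ u (y_idx i) = 0.
Proof.
move=> u0 ui fix_f; set v := (u - U_(y_idx i))%MM.
have ux j : u (x_idx j) = 0%N.
  by apply/eqP; rewrite -leqn0 -u0 /xdeg (bigD1 j) //= leq_addr.
have def_u : (v + U_(y_idx i))%MM = u by rewrite submK // lep1mP -lt0n.
have v0 : xdeg v = 0%N.
  by apply/eqP; rewrite -leqn0 -u0 -def_u xdegD leq_addr.
(* This monomial has degree 1 in the X variables, so the Taylor remainder has coefficient 0
   there. *)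
have xv : (xdeg (v + U_(x_idx i))%MM < 2)%N.
  rewrite xdegD v0 /xdeg (bigD1 i) //= mnm1E eqxx big1 // => j /negPf ji.
  by rewrite mnm1E x_idx_eq eq_sym ji.
have /(_ _ xv) := @shear_taylor f.
rewrite fix_f subrr sub0r mcoeffN => /eqP; rewrite oppr_eq0 => /eqP.
(* Only the summand of index i contributes: for j <> i, X_j does not divide the monomial
   [v + U_(x_idx i)]. *)
rewrite /xdy raddf_sum /= (bigD1 i) //= big1 => [|j /negPf ji]; last first.
  rewrite mulrC mcoeffM big1 // => k /eqP/(congr1 (fun w : 'X_{1..m.*2} => w (x_idx j))).
  rewrite !mnmDE mnm1E x_idx_eq eq_sym ji mnmBE ux => /esym/eqP.
  rewrite addn_eq0 => /andP[_ /eqP k2]; rewrite mcoeffX.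
  case: eqP => [def_k|_]; last by rewrite mulr0.
  by move: k2; rewrite -def_k mnm1E eqxx.
(* Differentiation yields the factor [v (y_idx i) + 1], which is [u (y_idx i)] because the latter is
   positive. *)
rewrite addr0 mulrC addmC mcoeffMX mcoeff_mderiv def_u.
by rewrite mnmBE mnm1E eqxx subn1 prednK.
Qed.

End Shear.

(** * Divisors of (Y_1 ... Y_m)^(p-1) as the standard monomials *)

Section StandardMonomials.

Variables (m p : nat) (p_gt0 : (0 < p)%N).
Implicit Types (u v t : 'X_{1..m.*2}) (i : 'I_m).

Definition top_mon : 'X_{1..m.*2} := ((\sum_(i < m) U_(y_idx i)) *+ p.-1)%MM.

(** All elements of [xy_groebner] are monomials; keeping only their exponents turns Gröbner
    questions into divisibility. *)
Definition xy_lead : seq 'X_{1..m.*2} :=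
  [seq U_(x_idx i)%MM | i <- enum 'I_m] ++
  [seq (U_(y_idx i) *+ p)%MM | i <- enum 'I_m].

Lemma xy_groebnerE (F : fieldType) :
  xy_groebner m p F = [seq 'X_[F, t] | t <- xy_lead].
Proof.
rewrite /xy_groebner /xy_lead map_cat -!map_comp; congr (_ ++ _).
by apply: eq_map => i /=; rewrite mpolyXn.
Qed.

Lemma xy_leadP t : reflect
  (exists i, t = U_(x_idx i)%MM \/ t = (U_(y_idx i) *+ p)%MM) (t \in xy_lead).
Proof.
rewrite mem_cat; apply: (iffP orP) => [[]/mapP[i _ ->]|[i [->|->]]].
- by exists i; left.
- by exists i; right.
- by left; apply: map_f; rewrite mem_enum.
- by right; apply: map_f; rewrite mem_enum.
Qed.

Lemma top_mon_x i : top_mon (x_idx i) = 0%N.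
Proof.
rewrite mulmnE mnm_sumE big1 // => j _.
by rewrite mnm1E y_neq_x.
Qed.

Lemma top_mon_y i : top_mon (y_idx i) = p.-1.
Proof.
rewrite mulmnE mnm_sumE (bigD1 i) //= mnm1E eqxx big1 ?mul1n // => j /negPf ji.
by rewrite mnm1E y_idx_eq ji.
Qed.

Lemma le_top_monP u : reflect
  (forall i, u (x_idx i) = 0%N /\ (u (y_idx i) < p)%N) (u <= top_mon)%MM.
Proof.
apply: (iffP mnm_lepP) => [le_u i | u_std k].
  have := le_u (x_idx i); have := le_u (y_idx i).
  rewrite top_mon_x top_mon_y leqn0 => uy /eqP->; split=> //.
  by rewrite -(ltn_predK p_gt0).
have [ux uy] := u_std (half_idx k); rewrite (xy_idxP k).
case: (odd k); first by rewrite top_mon_y -ltnS prednK.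
by rewrite ux.
Qed.

Lemma mulmU_le k e u : (U_(k) *+ e <= u)%MM = (e <= u k)%N.
Proof.
apply/mnm_lepP/idP => [/(_ k)|le_eu l].
  by rewrite mulmnE mnm1E eqxx mul1n.
by rewrite mulmnE mnm1E; case: eqP => [<-|_]; rewrite ?mul1n.
Qed.

(** Divisibility by X_i means a positive exponent at X_i, and by Y_i^p an exponent at least p at
    Y_i; [top_mon] bounds [u] exactly when both fail for every i. *)
Lemma has_xy_lead u :
  has (fun t => (t <= u)%MM) xy_lead = ~~ (u <= top_mon)%MM.
Proof.
apply/idP/idP => [/hasP[t /xy_leadP[i [->|->]]] | ].
- by rewrite lep1mP; apply: contra => /le_top_monP/(_ i)[->].
- by rewrite mulmU_le leqNgt; apply: contra => /le_top_monP/(_ i)[_ ->].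
apply: contraR => /hasPn no_lead; apply/le_top_monP => i; split.
  apply/eqP; rewrite -[_ == _]negbK -lep1mP; apply: no_lead.
  by apply/xy_leadP; exists i; left.
rewrite ltnNge -mulmU_le; apply: no_lead.
by apply/xy_leadP; exists i; right.
Qed.

(** Distinct elements involve distinct variables, and p > 0 keeps Y_i^p from being 1, which would
    divide everything. *)
Lemma xy_lead_antichain : {in xy_lead &, forall t u, (t <= u)%MM -> t = u}.
Proof.
move=> _ _ /xy_leadP[i [->|->]] /xy_leadP[j [->|->]].
- by rewrite lep1mP mnm1E x_idx_eq; case: (j =P i) => [->|].
- by rewrite lep1mP mulmnE mnm1E y_neq_x.
- by rewrite mulmU_le mnm1E x_neq_y leqNgt p_gt0.
rewrite mulmU_le mulmnE mnm1E y_idx_eq; case: eqP => [-> //|_].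
by rewrite mul0n leqNgt p_gt0.
Qed.

End StandardMonomials.

(** On the dual, sigma is the identity plus Delta, and the coordinates of a basis element are
    Kronecker deltas; so the substitution defining [sigma_act] adds X_i to Y_i and fixes X_i. *)
Lemma sigma_act_shear (m : nat) (F : fieldType) (V : vectType F) (s : 'End(V))
    (X Y : 'I_m -> dual V) :
    free (xy_tuple X Y) ->
    (forall i, dual_Delta s (Y i) = X i) ->
    (forall i, dual_Delta s (X i) = 0) ->
  sigma_act s (xy_tuple X Y) =1 @shear m F.
Proof.
move=> free_b DY DX f; rewrite /sigma_act /shear; congr (_ \mPo _).
apply: eq_from_tnth => k; rewrite !tnth_mktuple; set b := xy_tuple X Y.
have coord_b j : \sum_l coord b l (tnth b j) *: 'X_l = 'X_j :> {mpoly F[m.*2]}.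
  rewrite (bigD1 j) //= big1 => [|l /negPf lj].
    by rewrite (tnth_nth 0) coord_free // eqxx scale1r addr0.
  by rewrite (tnth_nth 0) coord_free // eq_sym lj scale0r.
have DE phi : dual_act s phi = phi + dual_Delta s phi.
  by rewrite addrC subrK.
have bx i : tnth b (x_idx i) = X i.
  by rewrite tnth_mktuple odd_x_idx x_idxK.
rewrite DE -[in RHS](coord_b k) {2}/b tnth_mktuple; case: ifP => _.
  rewrite DY -bx -[in RHS](coord_b (x_idx _)) -big_split.
  by apply: eq_bigr => l _; rewrite linearD scalerDl.
by rewrite DX addr0.
Qed.

(** * The Hilbert ideal by coefficients, and the coinvariants *)

Section HilbertIdeal.

Variables (m p : nat) (F : fieldType) (V : vectType F) (s : 'End(V)).
Variable b : m.*2.-tuple (dual V).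
Hypotheses (p_prime : prime p) (charF : p \in [pchar F]).
Hypothesis shearE : sigma_act s b =1 @shear m F.

Local Notation hilb := (hilbert_ideal p s b).
Local Notation class := (coinv_class p s b).

Lemma zp_invariantP f : zp_invariant p s b f <-> shear f = f.
Proof.
split=> [/(_ 1)|fix_f k]; first by rewrite /zp_act /= shearE.
by rewrite /zp_act; elim: (k : nat) => //= j ->; rewrite shearE.
Qed.

Lemma hilbert_x i : hilb 'X_(x_idx i).
Proof.
apply: ideal_gen_mem; split; last exact/zp_invariantP/shear_x.
by exists 1%N; rewrite // dhomogX /= mdeg1.
Qed.

(** This polynomial is the norm of Y_i, the product of Y_i + c X_i over c in the prime field. By
    Frobenius (Y_i + X_i)^p = Y_i^p + X_i^p, and the extra X_i^p cancels against that of X_i^(p-1)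
    (Y_i + X_i). *)
Lemma shear_norm i :
  shear ('X_(y_idx i) ^+ p - 'X_(x_idx i) ^+ p.-1 * 'X_(y_idx i)) =
  'X_(y_idx i) ^+ p - 'X_(x_idx i) ^+ p.-1 * 'X_(y_idx i) :> {mpoly F[m.*2]}.
Proof.
have pnat_p : [pchar {mpoly F[m.*2]}].-nat p.
  by rewrite pnatE // pchar_lalg.
rewrite shearB shearM !shearX shear_x shear_y exprDn_pchar // mulrDr -exprSr.
by rewrite prednK ?prime_gt0 // opprD addrACA subrr addr0.
Qed.

Lemma hilbert_yp i : hilb ('X_(y_idx i) ^+ p).
Proof.
set x : {mpoly F[m.*2]} := 'X_(x_idx i); set y : {mpoly F[m.*2]} := 'X_(y_idx i).
rewrite -(subrK (x ^+ p.-1 * y) (y ^+ p)).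
apply: ideal_genD; last first.
  (* Since p >= 2, a factor X_i can be split off X_i^(p-1) Y_i. *)
  have -> : p.-1 = p.-2.+1 by case: p p_prime => [|[]].
  by rewrite exprSr mulrAC; apply/ideal_gen_mull/hilbert_x.
apply: ideal_gen_mem; split; last exact/zp_invariantP/shear_norm.
exists p; first exact: prime_gt0.
have homU k : ('X_k : {mpoly F[m.*2]}) \is 1.-homog by rewrite dhomogX /= mdeg1.
rewrite rpredB //; first by have := dhomogMn p (homU (y_idx i)); rewrite mul1n.
have := dhomogM (dhomogMn p.-1 (homU (x_idx i))) (homU (y_idx i)).
by rewrite mul1n addn1 prednK ?prime_gt0.
Qed.

(** Homogeneity of positive degree kills the constant term. Otherwise [u] is a nonzero exponent in
    the Y_i alone, and some exponent lies strictly between 0 and p, hence is invertible in [F];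
    [shear_inv_coeff] applies. *)
Lemma invariant_coeff0 f d u : (0 < d)%N -> f \is d.-homog ->
  zp_invariant p s b f -> (u <= top_mon m p)%MM -> f@_u = 0.
Proof.
move=> d_gt0 homf /zp_invariantP fix_f /(le_top_monP (prime_gt0 p_prime)) std_u.
have [u0|] := eqVneq u 0%MM.
  by rewrite (dhomog_nemf_coeff homf) //= u0 mdeg0 eq_sym -lt0n.
have xdeg_u : xdeg u = 0%N by rewrite /xdeg big1 // => i _; case: (std_u i).
have [i ui _ | u0 /negP[]] := pickP (fun i => 0 < u (y_idx i))%N; last first.
  apply/eqP/mnmP => k; rewrite mnm0E (xy_idxP k).
  case: (odd k); last by case: (std_u (half_idx k)).
  by apply/eqP; rewrite -leqn0 leqNgt u0.
have /eqP := shear_inv_coeff xdeg_u ui fix_f; rewrite -mulr_natr mulf_eq0.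
rewrite -(dvdn_pcharf charF) gtnNdvd ?orbF //; first by move/eqP.
by case: (std_u i).
Qed.

(** Divisors of [top_mon] are closed under taking factors, so the vanishing of these coefficients
    passes from invariants to their multiples. Conversely every other monomial is a multiple of some
    X_i or Y_i^p. *)
Lemma hilbert_coeffP f :
  hilb f <-> forall u, (u <= top_mon m p)%MM -> f@_u = 0.
Proof.
split=> [[k [a [g [Sg ->]]]] u std_u | f0].
  rewrite raddf_sum big1 // => i _; rewrite /= mcoeffM big1 // => -[v w] /= /eqP def_u.
  have [[d d_gt0 homg] invg] := Sg i.
  rewrite (invariant_coeff0 d_gt0 homg invg) ?mulr0 //.
  by apply: lepm_trans std_u; have:= lem_addl v w; rewrite -def_u.
rewrite (mpolyE f); apply: (big_ind hilb) => [||u _].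
- exact: ideal_gen0.
- exact: ideal_genD.
have [/f0->|] := boolP (u <= top_mon m p)%MM.
  by rewrite scale0r; apply: ideal_gen0.
rewrite -has_xy_lead ?prime_gt0 // => /hasP[t Tt /mpolyX_dvd->].
rewrite -mul_mpolyC mulrA; apply: ideal_gen_mull.
have /xy_leadP[i [->|->]] := Tt; first exact: hilbert_x.
by rewrite -mpolyXn; apply: hilbert_yp.
Qed.

Lemma coinv_classZ c f : class (c *: f) = c *: class f.
Proof. by rewrite -mul_mpolyC /coinv_class rmorphM. Qed.

Lemma coinv_class_sum (r : seq 'X_{1..m.*2}) (c : 'X_{1..m.*2} -> F) :
  \sum_(u <- r) c u *: class 'X_[u] = class (\sum_(u <- r) c u *: 'X_[u]).
Proof.
rewrite {2}/coinv_class raddf_sum; apply: eq_bigr => u _.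
by rewrite -coinv_classZ.
Qed.

Lemma standard_basis :
  basis_family (fun u : 'X_{1..m.*2} => (u <= top_mon m p)%MM)
    (fun u => class 'X_[u]).
Proof.
split=> [x | r c uniq_r std_r].
  (* The coordinates of a class are the coefficients of a representative at the divisors of
     [top_mon]; the discarded terms lie in the Hilbert ideal. *)
  rewrite -[x]reprK -/(class (repr x)); set f := repr x.
  exists [seq u <- msupp f | (u <= top_mon m p)%MM], (fun u => f@_u).
  split=> [u|]; first by rewrite mem_filter => /andP[].
  rewrite coinv_class_sum; apply/coinv_classP/hilbert_coeffP => u std_u.
  rewrite mcoeffB mcoeff_sumX ?filter_uniq ?msupp_uniq // mem_filter std_u /=.
  by case: ifPn => [_|/memN_msupp_eq0->]; rewrite subrr.
have class0 : class 0 = 0 by rewrite /coinv_class rmorph0.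
rewrite coinv_class_sum -class0.
move=> /coinv_classP/hilbert_coeffP r0 u ur; have := r0 u (std_r u ur).
by rewrite subr0 mcoeff_sumX // ur.
Qed.

(** Both sides are ring morphisms in [f], and they agree on variables because X_i vanishes in the
    coinvariants. *)
Lemma coinv_class_shear f : class (shear f) = class f.
Proof.
elim/mpoly_alg_ind: f => [c|k|f g eq_f eq_g|f g eq_f eq_g].
- by rewrite shearC.
- rewrite (xy_idxP k); case: (odd k); last by rewrite shear_x.
  apply/coinv_classP; rewrite shear_y addrC addKr; exact: hilbert_x.
- by rewrite shearD /coinv_class !rmorphD; congr (_ + _).
by rewrite shearM /coinv_class !rmorphM; congr (_ * _).
Qed.

Lemma coinv_act_trivial (k : 'Z_p) (x : coinvariants p s b) : coinv_act k x = x.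
Proof.
rewrite -[RHS]reprK /coinv_act -/(class (repr x)) /zp_act.
by elim: (k : nat) => //= j <-; rewrite shearE coinv_class_shear.
Qed.

End HilbertIdeal.

Theorem theorem3p1 (p : nat) (p_prime : prime p)
    (F : fieldType) (charF : p \in [pchar F]) (m : nat) (m_gt0 : (0 < m)%N)
    (V : vectType F) (s : 'End(V)) (V_mV2 : is_mV m 2 s)
    (X Y : 'I_m -> dual V)
    (XY_basis : basis_of fullv (xy_tuple X Y))
    (DeltaY : forall i, dual_Delta s (Y i) = X i)
    (DeltaX : forall i, dual_Delta s (X i) = 0) :
  [/\ is_reduced_groebner (hilbert_ideal p s (xy_tuple X Y)) (xy_groebner m p F),
      basis_family (standard_monomial (xy_groebner m p F))
        (fun u => coinv_class p s (xy_tuple X Y) 'X_[u]),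
      forall u : 'X_{1..m.*2}, standard_monomial (xy_groebner m p F) u <->
        (u <= (\sum_(i < m) U_(y_idx i)) *+ p.-1)%MM
    & forall (k : 'Z_p) (x : coinvariants p s (xy_tuple X Y)),
        coinv_act k x = x].
Proof.
have p_gt0 := prime_gt0 p_prime.
have shearE := sigma_act_shear (basis_free XY_basis) DeltaY DeltaX.
have stdE (u : 'X_{1..m.*2}) :
    standard_monomial (xy_groebner m p F) u <-> (u <= top_mon m p)%MM.
  rewrite xy_groebnerE -[(u <= _)%MM]negbK -has_xy_lead //.
  exact: standard_monomialX.
split=> //; last exact: coinv_act_trivial.
- rewrite xy_groebnerE; apply: monomial_reduced_groebner.
  + move=> t /xy_leadP[i [->|->]]; first exact: hilbert_x.
    by rewrite -mpolyXn; apply: hilbert_yp.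
  (* A monomial divisible by no element of [xy_lead] divides [top_mon], so it cannot occur in
     [f]. *)
  + move=> f u /(hilbert_coeffP p_prime charF shearE) f0.
    rewrite has_xy_lead // mcoeff_msupp; apply: contra => std_u.
    by apply/eqP/f0.
  exact: xy_lead_antichain.
have [span indep] := standard_basis p_prime charF shearE.
split=> [x | r c uniq_r std_r]; last by apply: indep => // u /std_r/stdE.
have [r [c [std_r def_x]]] := span x.
by exists r, c; split=> // u /std_r/stdE.
Qed.
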